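(* Let $\mathbf{z}\in K_{\exp}^*$ with $z_x=0$ and $\{\mathbf{z}\}^\perp\cap K_{\exp}=\mathcal{F}_\infty$. (i) In the case $z_y>0$, let $\kappa_{\mathbf{z},t}:=\max\{2,2\gamma_{\mathbf{z},t}^{-1}\}$ for $t\ge0$, where $\gamma_{\mathbf{z},t}$ is defined with $\mathfrak{g}=|\cdot|$. Then the function $\psi_{\mathcal{K},\mathbf{z}}:\mathbb{R}_+\times\mathbb{R}_+\to\mathbb{R}_+$ given by $$\psi_{\mathcal{K},\mathbf{z}}(\epsilon,t):=\max\{\epsilon,\epsilon/\|\mathbf{z}\|\}+\kappa_{\mathbf{z},t}(\epsilon+\max\{\epsilon,\epsilon/\|\mathbf{z}\|\})$$ is a one-step facial residual function for $K_{\exp}$ and $\mathbf{z}$. In particular, there exist $\kappa>0$ and a nonnegative monotone nondecreasing function $\rho:\mathbb{R}_+\to\mathbb{R}_+$ such that $\hat\psi_{\mathcal{K},\mathbf{z}}(\epsilon,t):=\kappa\epsilon+\rho(t)\epsilon$ is a one-step facial residual function for $K_{\exp}$ and $\mathbf{z}$. (ii) In the case $z_y=0$, let $\kappa_{\mathbf{z},t}:=\max\{2,2\gamma_{\mathbf{z},t}^{-1}\}$ for $t\ge0$, where $\gamma_{\mathbf{z},t}$ is defined with $\mathfrak{g}=\mathfrak{g}_\infty$. Then the function $\psi_{\mathcal{K},\mathbf{z}}:\mathbb{R}_+\times\mathbb{R}_+\to\mathbb{R}_+$ given by $$\psi_{\mathcal{K},\mathbf{z}}(\epsilon,t):=\max\{\epsilon,\epsilon/\|\mathbf{z}\|\}+\kappa_{\mathbf{z},t}\,\mathfrak{g}_\infty(\epsilon+\max\{\epsilon,\epsilon/\|\mathbf{z}\|\})$$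 is a one-step facial residual function for $K_{\exp}$ and $\mathbf{z}$. In particular, there exist $\kappa>0$ and a nonnegative monotone nondecreasing function $\rho:\mathbb{R}_+\to\mathbb{R}_+$ such that $\hat\psi_{\mathcal{K},\mathbf{z}}(\epsilon,t):=\kappa\epsilon+\rho(t)\mathfrak{g}_\infty(\epsilon)$ is a one-step facial residual function for $K_{\exp}$ and $\mathbf{z}$.
   Context: $\mathbb{R}^3$ carries the standard inner product and Euclidean norm; vectors are written $\mathbf{p}=(p_x,p_y,p_z)$; $\mathbb{R}_+=[0,\infty)$. $K_{\exp}=\{(x,y,z):y>0,\ z\ge ye^{x/y}\}\cup\{(x,y,z):x\le0,\ z\ge0,\ y=0\}$ is the exponential cone, $K_{\exp}^*$ its dual cone, $\partial K_{\exp}$ its boundary, $\mathcal{F}_\infty=\{(x,0,0):x\le0\}$. $\mathfrak{g}_\infty:\mathbb{R}_+\to\mathbb{R}_+$ is given by $\mathfrak{g}_\infty(0)=0$, $\mathfrak{g}_\infty(t)=-1/\ln t$ for $0<t\le1/e^2$, $\mathfrak{g}_\infty(t)=\frac14+\frac14e^2t$ for $t>1/e^2$. For $\eta\ge0$ and $\mathfrak{g}:\mathbb{R}_+\to\mathbb{R}_+$, $$\gamma_{\mathbf{z},\eta}:=\inf_{\mathbf{v}}\left\{\frac{\mathfrak{g}(\|\mathbf{w}-\mathbf{v}\|)}{\|\mathbf{w}-\mathbf{u}\|}\;\Big|\;\mathbf{v}\in\partial K_{\exp}\cap B(\eta)\setminus\mathcal{F}_\infty,\ \mathbf{w}=P_{\{\mathbf{z}\}^\perp}\mathbf{v},\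 \mathbf{u}=P_{\mathcal{F}_\infty}\mathbf{w},\ \mathbf{w}\ne\mathbf{u}\right\},$$ where $B(\eta)$ is the closed ball of radius $\eta$ centered at the origin and $P_C$ is the orthogonal projection onto $C$; the infimum over the empty set is $+\infty$ and $1/\infty=0$. One-step facial residual function for a closed convex cone $\mathcal{K}$ and $\mathbf{z}\in\mathcal{K}^*$: a function $\psi:\mathbb{R}_+\times\mathbb{R}_+\to\mathbb{R}_+$ that is monotone nondecreasing in each argument, satisfies $\psi(0,t)=0$ for all $t$, and is such that for every $\mathbf{x}\in\mathrm{span}\,\mathcal{K}$ and $\epsilon\ge0$, $\mathrm{d}(\mathbf{x},\mathcal{K})\le\epsilon$ and $\langle\mathbf{x},\mathbf{z}\rangle\le\epsilon$ imply $\mathrm{d}(\mathbf{x},\mathcal{K}\cap\{\mathbf{z}\}^\perp)\le\psi(\epsilon,\|\mathbf{x}\|)$, where $\mathrm{d}(\cdot,C)$ is the distance to $C$. *)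

(* Defs.v *)
From HB Require Import structures.
From mathcomp Require Import all_boot all_order all_algebra.
From mathcomp Require Import all_classical all_reals all_analysis.

Set Implicit Arguments.
Unset Strict Implicit.
Unset Printing Implicit Defensive.

Import Order.TTheory GRing.Theory Num.Theory.
Import numFieldNormedType.Exports.

Local Open Scope classical_set_scope.
Local Open Scope ring_scope.

(* The library norm on 'rV[R]_n is the sup norm, so the Euclidean structure is
   introduced here. The library topology on 'rV[R]_n is the usual one and is
   used for boundaries. *)
Definition dot (R : realType) (n : nat) (x y : 'rV[R]_n) : R :=
  \sum_(i < n) x 0 i * y 0 i.

Definition enorm (R : realType) (n : nat) (x : 'rV[R]_n) : R :=
  Num.sqrt (dot x x).

Definition orth (R : realType) (n : nat) (z : 'rV[R]_n) : set 'rV[R]_n :=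
  [set x | dot x z = 0].

Definition dual_cone (R : realType) (n : nat) (K : set 'rV[R]_n) :
    set 'rV[R]_n :=
  [set z | forall x, K x -> 0 <= dot x z].

(* Valued in \bar R, so that the distance to the empty set is +oo. *)
Definition edistance (R : realType) (n : nat) (x : 'rV[R]_n)
    (C : set 'rV[R]_n) : \bar R :=
  ereal_inf [set (enorm (x - c))%:E | c in C].

(* p is a nearest point of C to x; such a p exists and is unique when C is
   nonempty, closed and convex. *)
Definition is_projection (R : realType) (n : nat) (C : set 'rV[R]_n)
    (x p : 'rV[R]_n) : Prop :=
  C p /\ forall q, C q -> enorm (x - p) <= enorm (x - q).

Definition linear_span (R : realType) (n : nat) (A : set 'rV[R]_n) :
    set 'rV[R]_n :=
  [set x | exists2 s : seq 'rV[R]_n,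
    (forall v : 'rV[R]_n, v \in s -> A v) & x \in span s].

Definition boundary (T : topologicalType) (A : set T) : set T :=
  closure A `\` interior A.

(* Functions from R_+ or R_+ x R_+ to R_+ are represented by functions on R of
   which only the values at nonnegative arguments matter. *)
Definition nonneg_nondecreasing (R : realType) (rho : R -> R) : Prop :=
  (forall t : R, 0 <= t -> 0 <= rho t) /\
  (forall s t : R, 0 <= s -> s <= t -> rho s <= rho t).

Definition one_step_FRF (R : realType) (n : nat) (K : set 'rV[R]_n)
    (z : 'rV[R]_n) (psi : R -> R -> R) : Prop :=
  [/\ forall e t : R, 0 <= e -> 0 <= t -> 0 <= psi e t,
      forall e1 e2 t : R, 0 <= e1 -> e1 <= e2 -> 0 <= t -> psi e1 t <= psi e2 t,
      forall e t1 t2 : R, 0 <= e -> 0 <= t1 -> t1 <= t2 -> psi e t1 <= psi e t2,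
      forall t : R, 0 <= t -> psi 0 t = 0 &
      forall (x : 'rV[R]_n) (e : R), linear_span K x -> 0 <= e ->
        (edistance x K <= e%:E)%E -> dot x z <= e ->
        (edistance x (K `&` orth z) <= (psi e (enorm x))%:E)%E].

Definition xc (R : realType) (p : 'rV[R]_3) : R := p 0 0.
Definition yc (R : realType) (p : 'rV[R]_3) : R := p 0 1.
Definition zc (R : realType) (p : 'rV[R]_3) : R := p 0 2.

Definition Kexp (R : realType) : set 'rV[R]_3 :=
  [set p | 0 < yc p /\ yc p * expR (xc p / yc p) <= zc p] `|`
  [set p | [/\ xc p <= 0, 0 <= zc p & yc p = 0]].

Definition Finf (R : realType) : set 'rV[R]_3 :=
  [set p | [/\ xc p <= 0, yc p = 0 & zc p = 0]].

Definition ginf (R : realType) (t : R) : R :=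
  if t == 0 then 0
  else if t <= 1 / expR 1 ^+ 2 then - 1 / ln t
  else 1 / 4 + 1 / 4 * expR 1 ^+ 2 * t.

Definition gamma (R : realType) (g : R -> R) (z : 'rV[R]_3) (eta : R) :
    \bar R :=
  ereal_inf [set r | exists v w u : 'rV[R]_3,
    [/\ ((@boundary 'rV[R]_3 (@Kexp R) `&` closed_ball_ (@enorm R 3) 0 eta)
           `\` @Finf R) v,
        is_projection (orth z) v w,
        is_projection (@Finf R) w u,
        w <> u &
        r = (g (enorm (w - v)) / enorm (w - u))%:E]].

(* The inverse on \bar R satisfies +oo^-1 = 0 and 0^-1 = +oo, hence
   kappa = +oo exactly when gamma = 0. *)
Definition kappa (R : realType) (g : R -> R) (z : 'rV[R]_3) (t : R) : \bar R :=
  maxe 2%:E (2%:E * (gamma g z t)^-1)%E.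

(* Main.v *)
(* A point x close to K and to the half-space <., z> <= 0 is first projected to
   the hyperplane orthogonal to z, giving q, and q is projected to the cone,
   giving a boundary point v. If d(q, F) > 2 d(q, K), projecting v back to the
   hyperplane (w) and then to F (u) gives d(q, F) <= 2 |w - u|, and the definition
   of gamma bounds |w - u| by gamma^-1 g(|w - v|) with |w - v| <= d(q, K).
   It remains to bound gamma below on each ball. If z_y > 0 then <v, z> controls
   v_y + v_z, hence the distance from v to F. If z_y = 0 then |w - v| = v_z; for
   v_x >= 0 the bound v_x + v_y <= v_z suffices, and for v_x < 0 one has |w - u| = v_y
   and -1 / ln (y exp (x / y)) = y / (- x - y ln y) >= c y on bounded sets. *)
Require Import Defs.
From HB Require Import structures.
From mathcomp Require Import all_boot all_order all_algebra.
From mathcomp Require Import all_classical all_reals all_analysis.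
From mathcomp Require Import ring lra.

Set Implicit Arguments.
Unset Strict Implicit.
Unset Printing Implicit Defensive.

Import Order.TTheory GRing.Theory Num.Theory.
Import numFieldNormedType.Exports.

Local Open Scope classical_set_scope.
Local Open Scope ring_scope.

(** * The Euclidean inner product and norm *)

Section Euclidean.
Variables (R : realType) (n : nat).
Implicit Types (x y z v w p q : 'rV[R]_n) (a : R) (C : set 'rV[R]_n).

Lemma dotC x y : dot x y = dot y x.
Proof. by apply: eq_bigr => i _; rewrite mulrC. Qed.

Lemma dotDl x y z : dot (x + y) z = dot x z + dot y z.
Proof. by rewrite -big_split; apply: eq_bigr => i _; rewrite mxE mulrDl. Qed.

Lemma dotZl a x y : dot (a *: x) y = a * dot x y.
Proof. by rewrite mulr_sumr; apply: eq_bigr => i _; rewrite mxE mulrA. Qed.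

Lemma dotNl x y : dot (- x) y = - dot x y.
Proof. by rewrite -scaleN1r dotZl mulN1r. Qed.

Lemma dotBl x y z : dot (x - y) z = dot x z - dot y z.
Proof. by rewrite dotDl dotNl. Qed.

Lemma dotDr x y z : dot z (x + y) = dot z x + dot z y.
Proof. by rewrite dotC dotDl !(dotC z). Qed.

Lemma dotZr a x y : dot x (a *: y) = a * dot x y.
Proof. by rewrite dotC dotZl dotC. Qed.

Lemma dotNr x y : dot x (- y) = - dot x y.
Proof. by rewrite dotC dotNl dotC. Qed.

Definition dotE := (dotDl, dotDr, dotNl, dotNr, dotZl, dotZr).

Lemma dot_ge0 x : 0 <= dot x x.
Proof. by apply: sumr_ge0 => i _; rewrite -expr2 sqr_ge0. Qed.

Lemma enorm_ge0 x : 0 <= enorm x.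
Proof. exact: sqrtr_ge0. Qed.

Lemma sqr_enorm x : enorm x ^+ 2 = dot x x.
Proof. exact/sqr_sqrtr/dot_ge0. Qed.

Lemma enorm_le x y : (enorm x <= enorm y) = (dot x x <= dot y y).
Proof. by rewrite -!sqr_enorm ler_sqr // nnegrE enorm_ge0. Qed.

Lemma enorm_eq0 x : (enorm x == 0) = (x == 0).
Proof.
apply/eqP/eqP => [x0|->]; last first.
  by rewrite /enorm /dot big1 ?sqrtr0 // => i _; rewrite mxE mul0r.
have /eqP : dot x x = 0 by rewrite -sqr_enorm x0 expr0n.
rewrite psumr_eq0 => [/allP h|i _]; last by rewrite -expr2 sqr_ge0.
apply/rowP => i; apply/eqP; rewrite mxE -sqrf_eq0 expr2.
by have := h i (mem_index_enum i).
Qed.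

Lemma enorm0 : enorm (0 : 'rV[R]_n) = 0.
Proof. by apply/eqP; rewrite enorm_eq0. Qed.

Lemma enorm_gt0 x : (0 < enorm x) = (x != 0).
Proof. by rewrite lt_def enorm_ge0 enorm_eq0 andbT. Qed.

Lemma enormZ a x : enorm (a *: x) = `|a| * enorm x.
Proof.
by rewrite /enorm dotZl dotZr mulrA -expr2 sqrtrM ?sqr_ge0 // sqrtr_sqr.
Qed.

Lemma enormN x : enorm (- x) = enorm x.
Proof. by rewrite /enorm dotNl dotNr opprK. Qed.

Lemma enorm_distC x y : enorm (x - y) = enorm (y - x).
Proof. by rewrite -opprB enormN. Qed.

Lemma cauchy_schwarz x y : `|dot x y| <= enorm x * enorm y.
Proof.
have [->|y0] := eqVneq y 0.
  by rewrite -[0](scale0r 0) dotZr mul0r normr0 mulr_ge0 ?enorm_ge0.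
rewrite -ler_sqr ?nnegrE ?mulr_ge0 ?enorm_ge0 // exprMn !sqr_enorm real_normK ?num_real//.
have y1 : 0 < dot y y by rewrite -sqr_enorm exprn_gt0 // enorm_gt0.
(* The expansion of this square is [dot y y] times the Cauchy-Schwarz defect. *)
have := dot_ge0 (dot y y *: x - dot x y *: y); rewrite !dotE (dotC y x).
set a := dot x y; set b := dot y y; set c := dot x x => h.
have {h} : 0 <= b * (c * b - a ^+ 2).
  by apply: le_trans h _; rewrite le_eqVlt; apply/orP; left; apply/eqP; ring.
by rewrite pmulr_rge0 // subr_ge0.
Qed.

Lemma enorm_triangle x y : enorm (x + y) <= enorm x + enorm y.
Proof.
rewrite -ler_sqr ?nnegrE ?addr_ge0 ?enorm_ge0 // sqrrD !sqr_enorm !dotE (dotC y x).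
have := le_trans (ler_norm _) (cauchy_schwarz x y); lra.
Qed.

Lemma enorm_dist_triangle y x z : enorm (x - z) <= enorm (x - y) + enorm (y - z).
Proof. by apply: le_trans (enorm_triangle _ _); rewrite addrA subrK. Qed.

Lemma enorm_orthD x y :
  dot x y = 0 -> enorm (x + y) ^+ 2 = enorm x ^+ 2 + enorm y ^+ 2.
Proof. by move=> xy; rewrite !sqr_enorm !dotE (dotC y x) xy addr0 add0r. Qed.

(** * Projection onto the hyperplane orthogonal to [z] *)

Lemma orth_proj_mem z v : z != 0 -> orth z (v - (dot v z / enorm z ^+ 2) *: z).
Proof.
rewrite -enorm_eq0 => z0.
by rewrite /orth /= dotBl dotZl -sqr_enorm divfK ?subrr // sqrf_eq0.
Qed.

Lemma orth_proj_pythagoras z v w (w0 := v - (dot v z / enorm z ^+ 2) *: z) :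
  z != 0 -> orth z w ->
  enorm (v - w) ^+ 2 = enorm (v - w0) ^+ 2 + enorm (w0 - w) ^+ 2.
Proof.
move=> z0 wz; have w0z : orth z w0 by exact: orth_proj_mem.
rewrite -enorm_orthD ?subrKA //.
have -> : v - w0 = (dot v z / enorm z ^+ 2) *: z by rewrite opprB addrC subrK.
by rewrite dotZl (dotC z) dotBl [dot w z]wz [dot w0 z]w0z subrr mulr0.
Qed.

Lemma orth_projection z v : z != 0 ->
  is_projection (orth z) v (v - (dot v z / enorm z ^+ 2) *: z).
Proof.
move=> z0; split=> [|w wz]; first exact: orth_proj_mem.
by rewrite -ler_sqr ?nnegrE ?enorm_ge0 // (orth_proj_pythagoras v z0 wz) lerDl sqr_ge0.
Qed.

(** Minimality of [w] leaves no room in the Pythagorean identity for a nonzero [w0 - w], so the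
    projection is given by the explicit formula. *)
Lemma is_projection_orth z v w : z != 0 -> is_projection (orth z) v w ->
  w = v - (dot v z / enorm z ^+ 2) *: z.
Proof.
move=> z0 [wz wmin]; have /= := orth_proj_pythagoras v z0 wz.
have := wmin _ (orth_proj_mem v z0); rewrite -ler_sqr ?nnegrE ?enorm_ge0 //.
set w0 := v - _ *: _ => h1 h2; have h3 := sqr_ge0 (enorm (w0 - w)).
have : enorm (w0 - w) ^+ 2 == 0 by apply/eqP; lra.
by rewrite sqrf_eq0 enorm_eq0 subr_eq0 => /eqP <-.
Qed.

(** * Nearest points of closed sets and of cones *)

Lemma enorm_continuous : continuous (@enorm R n : 'rV[R]_n -> R).
Proof.
move=> x; apply: (@continuous_comp _ _ _ (fun y : 'rV[R]_n => dot y y));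
  last exact: sqrt_continuous.
rewrite /continuous_at /dot.
apply: cvg_big => [||i _]; [exact: add_continuous|exact: nbhs_filter|].
by apply: cvgM; [exact: nbhs_filter|exact: coord_continuous..].
Qed.

Lemma coord_le_enorm x i : `|x 0 i| <= enorm x.
Proof.
rewrite -ler_sqr ?nnegrE ?enorm_ge0 // sqr_enorm real_normK ?num_real //.
rewrite /dot (bigD1 i) //= -expr2 lerDl sumr_ge0 // => j _.
by rewrite -expr2 sqr_ge0.
Qed.

Lemma edist_le x p C e : C p -> enorm (x - p) <= e -> (edistance x C <= e%:E)%E.
Proof.
move=> Cp h; apply: (@le_trans _ _ (enorm (x - p))%:E); last by rewrite lee_fin.
by apply: ereal_inf_lbound; exists p.
Qed.

Lemma nearest_point_exists C x : C !=set0 -> closed C -> exists p, is_projection C x p.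
Proof.
move=> [c0 Cc0] clC.
(* Only points at least as close as [c0] compete; they form a compact set, on which the distance
   attains its minimum. *)
pose A := C `&` [set c | enorm (x - c) <= enorm (x - c0)].
have fc : continuous (fun c : 'rV[R]_n => enorm (x - c)).
  move=> c; apply: continuous_comp; last exact: enorm_continuous.
  by apply: continuousB; [exact: cst_continuous|exact: cvg_id].
have clA : closed A.
  apply: closedI => //.
  apply: (@preimage_closed _ _ (fun c : 'rV[R]_n => enorm (x - c))
    [set y | y <= enorm (x - c0)]); last exact: closed_le.
  by move=> c _; exact: fc.
have bA : bounded_set A.
  exists (enorm x + enorm (x - c0)); split; first by rewrite num_real.
  move=> M hM c [_ /= hc]; apply: le_trans (ltW hM).
  rewrite /Num.norm /= mx_normrE; apply: bigmax_le.
    by rewrite addr_ge0 ?enorm_ge0.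
  move=> [i j] _; rewrite (ord1 i) /=; apply: le_trans (coord_le_enorm _ _) _.
  rewrite -[c](subKr x); apply: le_trans (enorm_triangle _ _) _.
  by rewrite enormN lerD2l.
have cA := bounded_closed_compact bA clA.
have A0 : A !=set0 by exists c0; split => //=.
have [p /set_mem [Cp hp] pmin] := EVT_min_rV A0 cA (continuous_subspaceT fc).
exists p; split => // q Cq; have [hq|hq] := leP (enorm (x - q)) (enorm (x - c0)).
  by apply: pmin; apply/mem_set; split.
by apply: le_trans (ltW hq).
Qed.

Lemma projection_edist C x p e : is_projection C x p ->
  (edistance x C <= e%:E)%E -> enorm (x - p) <= e.
Proof.
move=> [Cp pmin] h; rewrite -lee_fin; apply: le_trans h.
by apply: le_ereal_inf_tmp => _ [q Cq <-]; rewrite lee_fin; exact: pmin.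
Qed.

(** From an interior point [p] one could move slightly towards [x] inside [C] and get closer. *)
Lemma projection_boundary C x p :
  ~ C x -> is_projection C x p -> (@boundary 'rV[R]_n C) p.
Proof.
move=> nCx [Cp pmin]; split; first exact: subset_closure.
move=> ip.
have cont : {for 0, continuous (fun s : R => p + s *: (x - p))}.
  apply: continuousD; first exact: cst_continuous.
  by apply: continuousZl; exact: cvg_id.
have near0 : \forall s \near (0 : R), C (p + s *: (x - p)).
  by apply: (cont C); rewrite scale0r addr0.
have /nbhs_ballP[e /= e0 he] := near0.
(* [e / 2] keeps the moved point in the ball, and [1 / 2] keeps the factor [1 - s] positive. *)
pose s := Num.min (e / 2) (1 / 2).
have s0 : 0 < s by rewrite lt_min; apply/andP; split; lra.
have s1 : s <= 1 / 2 by rewrite ge_min lexx orbT.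
have se : s <= e / 2 by rewrite ge_min lexx.
have Cs : C (p + s *: (x - p)).
  by apply: he; rewrite /ball /= sub0r normrN gtr0_norm //; lra.
have := pmin _ Cs.
have -> : x - (p + s *: (x - p)) = (1 - s) *: (x - p).
  by rewrite opprD addrA scalerBl scale1r.
rewrite enormZ ger0_norm; last lra.
have xp : 0 < enorm (x - p).
  by rewrite enorm_gt0 subr_eq0; apply/eqP => xp; apply: nCx; rewrite xp.
move=> h; nra.
Qed.

Lemma projection_cone_enorm C x p : (forall a y, 0 < a -> C y -> C (a *: y)) ->
  is_projection C x p -> enorm p <= enorm x.
Proof.
(* Comparing p with its positive multiples replaces convexity of C. *)
move=> cone [Cp pmin]; rewrite enorm_le.
have key a : 0 < a -> 0 <= (a ^+ 2 - 1) * dot p p - 2 * (a - 1) * dot x p.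
  move=> a0; have := pmin _ (cone _ _ a0 Cp); rewrite enorm_le !dotE (dotC p x); lra.
have p0 := dot_ge0 p; have h0 := dot_ge0 (x - p); move: h0; rewrite !dotE (dotC p x).
(* Together with [0 <= dot (x - p) (x - p)] this yields [dot p p <= dot x x]. *)
suff : dot x p >= dot p p by lra.
rewrite leNgt; apply/negP => lt_.
have p1 : 0 < dot p p.
  rewrite lt_def p0 andbT; apply/eqP => h.
  by have := key (1 / 2) ltac:(lra); have := key 2 ltac:(lra); lra.
(* Were [dot x p < dot p p], shrinking [p] to [(1 - d) *: p] would bring it closer to [x]; the
   second bound on [d] makes the linear gain exceed the quadratic loss. *)
pose d := Num.min (1/2) ((dot p p - dot x p) / dot p p).
have d0 : 0 < d by rewrite lt_min; apply/andP; split; [lra|apply: divr_gt0 => //; lra].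
have d1 : d <= 1/2 by rewrite ge_min lexx.
have d2 : d * dot p p <= dot p p - dot x p by rewrite -ler_pdivlMr // ge_min lexx orbT.
have := key (1 - d) ltac:(lra).
nra.
Qed.

(** Used to drop absolute values, which are the identity on the nonnegative arguments that
    matter. *)
Lemma eq_one_step_FRF (K : set 'rV[R]_n) z (psi1 psi2 : R -> R -> R) :
  (forall e t, 0 <= e -> 0 <= t -> psi1 e t = psi2 e t) ->
  one_step_FRF K z psi1 -> one_step_FRF K z psi2.
Proof.
move=> E [h1 h2 h3 h4 h5]; split.
- by move=> e t e0 t0; rewrite -E // h1.
- by move=> e1 e2 t e0 e12 t0; rewrite -!E ?h2 // (le_trans e0).
- by move=> e t1 t2 e0 t0 t12; rewrite -!E ?h3 // (le_trans t0).
- by move=> t t0; rewrite -E // h4.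
- by move=> x e sx e0 xK xz; rewrite -E ?enorm_ge0 // h5.
Qed.

End Euclidean.

(** * Growth estimates for [ginf] *)

Section GInf.
Variable R : realType.
Implicit Types s t L y a : R.

Lemma ln_le_sub1 t : 0 < t -> ln t <= t - 1.
Proof. by move=> t0; have := @le_ln1Dx R (t - 1); rewrite subrKC; apply; lra. Qed.

Lemma expR1_ge2 : 2 <= expR 1 :> R.
Proof. by have := expR_ge1Dx (1 : R); lra. Qed.

Lemma expR1_sqr : expR 1 ^+ 2 = expR 2 :> R.
Proof. by rewrite -expRM_natr mul1r. Qed.

Lemma ginf_cutE : 1 / expR 1 ^+ 2 = expR (- 2) :> R.
Proof. by rewrite expRN mul1r expR1_sqr. Qed.

Lemma ginf0 : ginf (0 : R) = 0.
Proof. by rewrite /ginf eqxx. Qed.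

Lemma ginf_low t : 0 < t -> t <= expR (- 2) -> ginf t = (- ln t)^-1.
Proof.
by move=> t0 t2; rewrite /ginf gt_eqF // ginf_cutE t2 invrN mulN1r.
Qed.

Lemma ginf_high t : expR (- 2) < t -> ginf t = 1 / 4 + expR 2 * t / 4.
Proof.
move=> t2; have t0 : 0 < t by apply: lt_trans t2; exact: expR_gt0.
rewrite /ginf gt_eqF // ginf_cutE leNgt t2 /= expR1_sqr; lra.
Qed.

Lemma ln_low t : 0 < t -> (t <= expR (- 2)) = (ln t <= - 2).
Proof. by move=> t0; rewrite -ler_ln ?posrE ?expR_gt0 // expRK. Qed.

Lemma expR2N : expR 2 * expR (- 2) = 1 :> R.
Proof. by rewrite -expRD subrr expR0. Qed.

(** Below the breakpoint, [ln t^-1 <= t^-1 - 1] gives [- ln t <= t^-1]; above it, the slope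
    [expR 2 / 4] is at least 1. *)
Lemma ginf_id_le t : 0 <= t -> t <= ginf t.
Proof.
rewrite le_eqVlt => /orP[/eqP <-|t0]; first by rewrite ginf0.
have [t2|t2] := leP t (expR (- 2)).
  rewrite ginf_low //; move: t2; rewrite ln_low // => l2.
  have := @ln_le_sub1 t^-1; rewrite invr_gt0 lnV ?posrE // => /(_ t0) h.
  rewrite -[leLHS]invrK lef_pV2 ?posrE ?invr_gt0 //; lra.
rewrite ginf_high //.
have : 4 <= expR 2 :> R by rewrite -expR1_sqr expr2; have := expR1_ge2; nra.
nra.
Qed.

Lemma ginf_ge0 t : 0 <= t -> 0 <= ginf t.
Proof. by move=> t0; apply: le_trans (ginf_id_le t0). Qed.

Lemma ginf_mono s t : 0 <= s -> s <= t -> ginf s <= ginf t.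
Proof.
rewrite le_eqVlt => /orP[/eqP <- t0|s0 st]; first by rewrite ginf0 ginf_ge0.
have t0 := lt_le_trans s0 st.
have [s2|s2] := leP s (expR (- 2)); last first.
  have e0 := expR_gt0 (2 : R).
  by rewrite !ginf_high ?(lt_le_trans s2) //; nra.
have ls : ln s <= - 2 by rewrite -ln_low.
rewrite (ginf_low s0 s2); have [t2|t2] := leP t (expR (- 2)).
  rewrite ginf_low //; have lt : ln t <= - 2 by rewrite -ln_low.
  have : ln s <= ln t by rewrite ler_ln ?posrE.
  by rewrite lef_pV2 ?posrE; lra.
(* Both branches take the value 1/2 at the breakpoint [expR (- 2)], which separates them here. *)
rewrite ginf_high //; apply: (@le_trans _ _ (1 / 2)).
  by rewrite -[leRHS]invrK lef_pV2 ?posrE ?invr_gt0; lra.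
have := expR2N; have := expR_gt0 (2 : R); nra.
Qed.

(* [ginf t / t] is nonincreasing, as for any concave function vanishing at 0. *)
Lemma ginf_scale L t : 1 <= L -> 0 <= t -> ginf (L * t) <= L * ginf t.
Proof.
move=> L1; rewrite le_eqVlt => /orP[/eqP <-|t0]; first by rewrite mulr0 ginf0 mulr0.
have L0 : 0 < L by lra.
have Lt0 : 0 < L * t by exact: mulr_gt0.
have tL : t <= L * t by nra.
have lL := ln_le_sub1 L0; have lL0 : 0 <= ln L by exact: ln_ge0.
have [Lt2|Lt2] := leP (L * t) (expR (- 2)).
  have t2 := le_trans tL Lt2.
  rewrite !ginf_low //; move: Lt2; rewrite ln_low // lnM ?posrE // => h.
  have h0 : ln t <= - 2 by rewrite -ln_low.
  rewrite -[leRHS]invrK invfM invrK lef_pV2 ?posrE ?mulr_gt0 ?invr_gt0 //; try lra.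
  (* Combines [ln L <= L - 1] with [- ln (L * t) >= 2]. *)
  rewrite mulrC ler_pdivrMr //; nra.
rewrite ginf_high //; have [t2|t2] := leP t (expR (- 2)); last first.
  by rewrite ginf_high //; nra.
rewrite ginf_low //; have h0 : ln t <= - 2 by rewrite -ln_low.
(* Scaling crosses the breakpoint. This tangent bound gives [- ln t * (expR 2 * t) <= 2], and
   [expR 2 * (L * t) > 1] absorbs the constant 1/4 of the upper branch. *)
have := expR_ge1Dx (- ln t - 2); rewrite expRD expRN lnK ?posrE //.
have E2 := expR2N; have e0 := expR_gt0 (2 : R).
have e2 : expR 2 * (L * t) > 1 by rewrite -(ltr_pM2l e0) E2 in Lt2.
move=> h.
have h1 : - ln t * (expR 2 * t) <= 2.
  have : (- ln t / 2) <= t^-1 * expR (- 2) by lra.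
  rewrite -(ler_pM2r t0) -(ler_pM2r e0) => h2.
  have E3 : t^-1 * expR (- 2) * t * expR 2 = 1.
    by rewrite (mulrAC _ _ t) mulVf ?gt_eqF // mul1r mulrC expR2N.
  by move: h2; rewrite E3; lra.
rewrite ler_pdivlMr; last lra.
nra.
Qed.

(** On the lower branch the value is [y / (- a - y * ln y)], and [- y * ln y <= 1 - y] bounds the
    denominator by [1 + eta]. On the upper branch the value exceeds 1/2, whence the factor 2. *)
Lemma ginf_perspective_ge a y eta : 0 < y -> y <= eta -> a <= 0 -> - a <= eta ->
  y / (2 * (1 + eta)) <= ginf (y * expR (a / y)).
Proof.
move=> y0 yeta a0 aeta.
have e0 : 0 < expR (a / y) by exact: expR_gt0.
have eta0 : 0 < 2 * (1 + eta) by lra.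
have [h|h] := leP (y * expR (a / y)) (expR (- 2)); last first.
  rewrite ginf_high // ler_pdivrMr //.
  have E0 := expR_gt0 (2 : R); have : 1 < expR 2 * (y * expR (a / y)).
    by rewrite -(ltr_pM2l E0) expR2N in h.
  set u := expR 2 * _; nra.
rewrite ginf_low ?mulr_gt0 //; move: h.
rewrite ln_low ?mulr_gt0 // lnM ?posrE // expRK => h.
have := @ln_le_sub1 y^-1; rewrite invr_gt0 lnV ?posrE // => /(_ y0) hy.
rewrite -[leLHS]invrK lef_pV2 ?posrE ?invr_gt0 ?divr_gt0 //; last lra.
rewrite invf_div ler_pdivlMr // mulNr mulrDl divfK ?gt_eqF //.
have yy : y^-1 * y = 1 by rewrite mulVf // gt_eqF.
nra.
Qed.

End GInf.

(** * Geometry of the exponential cone and of its face [Finf] *)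

Section ExponentialCone.
Variable R : realType.
Implicit Types (p q v w u x z : 'rV[R]_3) (g h : R -> R) (t e c : R).

Lemma dot3E x y : dot x y = xc x * xc y + yc x * yc y + zc x * zc y.
Proof.
rewrite /dot 3!big_ord_recl big_ord0 addr0 addrA /xc /yc /zc.
by congr (_ * _ + _ * _ + _ * _); congr (_ 0 _); apply/val_inj.
Qed.

Lemma coordB x y :
  [/\ xc (x - y) = xc x - xc y, yc (x - y) = yc x - yc y & zc (x - y) = zc x - zc y].
Proof. by rewrite /xc /yc /zc !mxE. Qed.

Lemma coordZ c x :
  [/\ xc (c *: x) = c * xc x, yc (c *: x) = c * yc x & zc (c *: x) = c * zc x].
Proof. by rewrite /xc /yc /zc !mxE. Qed.

(* The map [y * expR (x / y)] is the supremum over [s] of its tangents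
   [expR s * (x + (1 - s) * y)], which exhibits the cone as an intersection of
   closed half-spaces. *)
Lemma KexpP p : Kexp p <->
  [/\ 0 <= yc p, 0 <= zc p & forall s, expR s * (xc p + (1 - s) * yc p) <= zc p].
Proof.
split=> [[[y0 h]|[x0 z0 y0]]|[y0 z0 h]].
- split; first exact: ltW.
    by apply: le_trans h; rewrite mulr_ge0 ?expR_ge0 // ltW.
  move=> s; apply: le_trans h.
  have := expR_ge1Dx (xc p / yc p - s).
  rewrite expRD expRN -(ler_pM2r y0) -(ler_pM2l (expR_gt0 s)).
  have es := expR_gt0 s.
  have -> : expR s * (expR (xc p / yc p) / expR s * yc p) = yc p * expR (xc p / yc p).
    by rewrite mulrC -!mulrA (mulrCA _ (yc p)) mulVf ?gt_eqF // mulr1 mulrC.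
  have -> // : expR s * ((1 + (xc p / yc p - s)) * yc p) =
      expR s * (xc p + (1 - s) * yc p).
  have yy : xc p / yc p * yc p = xc p by rewrite divfK ?gt_eqF.
  by rewrite -{2}yy; ring.
- split; rewrite ?y0 // => s; rewrite mulr0 addr0.
  by apply: le_trans z0; rewrite mulr_ge0_le0 ?expR_ge0.
- move: y0; rewrite le_eqVlt => /orP[/eqP y0|y0].
    right; split => //; rewrite leNgt; apply/negP => x0.
    (* If [xc p > 0] on the plane [yc p = 0], this slope would give [xc p + zc p <= zc p]. *)
    have := h (zc p / xc p); rewrite -y0 mulr0 addr0.
    have := expR_ge1Dx (zc p / xc p); rewrite -(ler_pM2r x0) mulrDl divfK ?gt_eqF //; lra.
  (* At the tangency parameter the tangent equals [yc p * expR (xc p / yc p)]. *)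
  left; split => //; have := h (xc p / yc p).
  by rewrite mulrBl divfK ?gt_eqF // mul1r addrCA subrr addr0 mulrC.
Qed.


Lemma dot_continuous x : continuous (fun p : 'rV[R]_3 => dot x p).
Proof.
move=> p; rewrite /dot.
apply: cvg_big => [||i _]; [exact: add_continuous|exact: nbhs_filter|].
by apply: cvgM; [|apply: cvg_cst|exact: coord_continuous]; exact: nbhs_filter.
Qed.

Lemma Kexp_closed : closed (@Kexp R : set 'rV[R]_3).
Proof.
(* The real indices give the tangent half-spaces; the two booleans give [0 <= yc p] and
   [0 <= zc p]. *)
have -> : @Kexp R = \bigcap_(i : R + bool)
    [set p | dot (match i with
      | inl s => \row_j nth 0 [:: expR s; expR s * (1 - s); -1] j
      | inr true => \row_j nth 0 [:: 0; -1; 0] j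
      | inr false => \row_j nth 0 [:: 0; 0; -1] j end) p <= 0].
  apply/seteqP; split=> p.
    move=> /KexpP[y0 z0 h] [s|[]] _ /=; rewrite dot3E /xc /yc /zc !mxE /=.
    - by have := h s; rewrite /xc /yc /zc; lra.
    - by rewrite /yc in y0; lra.
    - by rewrite /zc in z0; lra.
  move=> h; apply/KexpP; split.
  - by have := h (inr true) I; rewrite /= dot3E /xc /yc /zc !mxE /=; lra.
  - by have := h (inr false) I; rewrite /= dot3E /xc /yc /zc !mxE /=; lra.
  - by move=> s; have := h (inl s) I; rewrite /= dot3E /xc /yc /zc !mxE /=; lra.
apply: closed_bigI => i _; apply: (@preimage_closed _ _ (dot _) [set y | y <= 0]).
  by move=> p _; exact: dot_continuous.
exact: closed_le.
Qed.

Lemma Kexp_cone c p : 0 < c -> Kexp p -> Kexp (c *: p).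
Proof.
move=> c0 /KexpP[y0 z0 h]; apply/KexpP; have [-> -> ->] := coordZ c p.
split; [by rewrite mulr_ge0 // ltW| by rewrite mulr_ge0 // ltW |] => s.
by rewrite (mulrCA (1 - s)) -mulrDr mulrCA ler_pM2l.
Qed.

(** The tangent at [s = 0]; it controls a positive first coordinate when bounding [gamma]. *)
Lemma Kexp_xc_le p : Kexp p -> xc p + yc p <= zc p.
Proof. by move=> /KexpP[_ _ /(_ 0)]; rewrite expR0 subr0 !mul1r. Qed.

Definition Finf_proj p : 'rV[R]_3 := Num.min (xc p) 0 *: delta_mx 0 0.

Lemma Finf_projE p :
  [/\ xc (Finf_proj p) = Num.min (xc p) 0, yc (Finf_proj p) = 0 & zc (Finf_proj p) = 0].
Proof. by rewrite /xc /yc /zc !mxE /= mulr1 !mulr0. Qed.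

Lemma Finf_proj_is_projection p : is_projection (@Finf R) p (Finf_proj p).
Proof.
have [ex ey ez] := Finf_projE p.
split=> [|q [qx qy qz]]; first by split; rewrite ?ex ?ey ?ez // ge_min lexx orbT.
rewrite enorm_le !dot3E.
have [-> -> ->] := coordB p (Finf_proj p); have [-> -> ->] := coordB p q.
rewrite ex ey ez qy qz; case: (leP (xc p) 0) => h; have := sqr_ge0 (xc p - xc q); nra.
Qed.

(** * Bounds for [gamma] and [kappa] *)

Lemma gamma_ge g z c t :
  (forall v w u, Kexp v -> enorm v <= t -> is_projection (orth z) v w ->
    is_projection (@Finf R) w u -> c * enorm (w - u) <= g (enorm (w - v))) ->
  (c%:E <= gamma g z t)%E.
Proof.
move=> h; apply: le_ereal_inf_tmp => _ [v [w [u [[[[clv _] vt] _] vw wu nwu ->]]]].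
have wu0 : 0 < enorm (w - u) by rewrite enorm_gt0 subr_eq0; apply/eqP.
(* Closedness puts the boundary point [v] in the cone itself. *)
rewrite lee_fin ler_pdivlMr //; apply: h => //; first exact: Kexp_closed.
by move: vt; rewrite /closed_ball_ /= sub0r enormN.
Qed.

Lemma gamma_le g z t s : s <= t -> (gamma g z t <= gamma g z s)%E.
Proof.
move=> st; apply: ereal_inf_le_tmp => _ [v [w [u [[[bv vs] nv] vw wu nwu ->]]]].
by exists v, w, u; split => //; split => //; split => //; exact: le_trans st.
Qed.

Lemma kappa_fin_num g z t c : 0 < c -> (c%:E <= gamma g z t)%E ->
  kappa g z t \is a fin_num.
Proof.
rewrite /kappa => c0; case: (gamma g z t) => [r| |//].
  rewrite lee_fin => cr; have r0 : 0 < r by lra.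
  by rewrite inver gt_eqF // -EFinM -EFin_max.
(* An infinite [gamma] has inverse 0, so [kappa] is still finite. *)
by move=> _; rewrite invey mule0 -EFin_max.
Qed.

Lemma kappa_ge2 g z t : kappa g z t \is a fin_num -> 2 <= fine (kappa g z t).
Proof. by move=> h; rewrite -lee_fin fineK // /kappa le_max lexx. Qed.

Lemma kappa_ge_inv g z t r c : 0 < c -> (c%:E <= gamma g z t)%E ->
  (gamma g z t <= r%:E)%E -> 2 / r <= fine (kappa g z t).
Proof.
move=> c0 cg; rewrite -lee_fin fineK; last exact: kappa_fin_num cg.
rewrite /kappa; case: (gamma g z t) cg => [s| |] //; rewrite !lee_fin => cs sr.
have s0 : 0 < s by lra.
by rewrite inver gt_eqF // -EFinM -EFin_max lee_fin le_max ler_pM2l //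
  lef_pV2 ?posrE ?sr ?orbT //; lra.
Qed.

Lemma kappa_mono g z s t c : s <= t -> 0 < c -> (c%:E <= gamma g z t)%E ->
  fine (kappa g z s) <= fine (kappa g z t).
Proof.
move=> st c0 cg; have gst := gamma_le g z st.
rewrite -lee_fin !fineK;
  [|exact: kappa_fin_num cg|exact: kappa_fin_num (le_trans cg gst)].
rewrite /kappa ge_max le_max lexx /= le_max; apply/orP; right.
apply: lee_wpmul2l; first by rewrite lee_fin.
by rewrite lee_pV2 // inE; do ?[apply: le_trans gst]; apply: le_trans cg;
  rewrite lee_fin ltW.
Qed.

(** The properties shared by the absolute value and [ginf], so that one error bound serves both
    cases. *)
Definition gauge g :=
  [/\ g 0 = 0, forall t, 0 <= t -> t <= g t &
      forall s t, 0 <= s -> s <= t -> g s <= g t].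

Definition gamma_positive g z :=
  forall t, 0 <= t -> exists2 c, 0 < c & (c%:E <= gamma g z t)%E.

(** * From positivity of [gamma] to residual functions *)

Section Residual.
Variables (z : 'rV[R]_3) (g : R -> R).
Hypotheses (z0 : z != 0) (hface : orth z `&` @Kexp R = @Finf R).
Hypotheses (hg : gauge g) (hgamma : gamma_positive g z).

Lemma error_bound q v t : orth z q -> enorm q <= t -> is_projection (@Kexp R) q v ->
  exists2 p, Finf p & enorm (q - p) <= fine (kappa g z t) * g (enorm (q - v)).
Proof.
move=> qz qt qv; have [g0 gid gmono] := hg.
have t0 : 0 <= t by apply: le_trans qt; exact: enorm_ge0.
have [c c0 cg] := hgamma t0.
have k2 := kappa_ge2 (kappa_fin_num c0 cg).
set k := fine _ in k2 *; set d := enorm (q - v).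
have d0 : 0 <= d by exact: enorm_ge0.
have gd := gid _ d0.
(* Settles every case in which the distance from [q] to the face is at most [2 * d]. *)
have kd : 2 * d <= k * g d by nra.
have [Kq|nKq] := pselect (Kexp q).
  exists q; first by rewrite -hface.
  by rewrite subrr enorm0; nra.
have [Kv vmin] := qv.
have [Fv|nFv] := pselect (Finf v); first by exists v => //; rewrite -/d; lra.
have pw := orth_projection v z0; set w := (v - _ *: z) in pw.
have qw : enorm (q - v) ^+ 2 = enorm (v - w) ^+ 2 + enorm (w - q) ^+ 2.
  by rewrite enorm_distC (orth_proj_pythagoras v z0 qz).
have wv : enorm (w - v) <= d.
  rewrite -ler_sqr ?nnegrE ?enorm_ge0 // /d qw (enorm_distC w v) lerDl sqr_ge0 //.
have qwd : enorm (q - w) <= d.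
  by rewrite -ler_sqr ?nnegrE ?enorm_ge0 // /d qw (enorm_distC q w) lerDr sqr_ge0.
have pu := Finf_proj_is_projection w; set u := Finf_proj w in pu.
have Fu : Finf u by case: pu.
exists u => //.
have [wu|/eqP nwu] := eqVneq w u; first by rewrite -wu; lra.
have tri := enorm_dist_triangle w q u.
(* When [enorm (q - u) > 2 * d], the triangle inequality through [w] and [qwd] give
   [enorm (q - u) <= 2 * enorm (w - u)]; this is the factor 2 in front of the inverse of [gamma]. *)
have [qu|qu] := leP (enorm (q - u)) (2 * d); first by lra.
have wu0 : 0 < enorm (w - u) by rewrite enorm_gt0 subr_eq0; apply/eqP.
have gr : (gamma g z t <= (g (enorm (w - v)) / enorm (w - u))%:E)%E.
  apply: ereal_inf_lbound; exists v, w, u; split => //; split => //; split.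
    exact: projection_boundary qv.
  rewrite /closed_ball_ /= sub0r enormN; apply: le_trans qt.
  (* Projecting onto a cone does not increase the norm, so [v] stays in the ball of radius [t]. *)
  by apply: projection_cone_enorm qv => a y; exact: Kexp_cone.
have := le_trans cg gr; rewrite lee_fin => cr.
have gw0 : 0 < g (enorm (w - v)).
  by have := lt_le_trans c0 cr; rewrite pmulr_lgt0 // invr_gt0.
have := kappa_ge_inv c0 cg gr; rewrite -/k invf_div mulrA ler_pdivrMr // => h1.
have h2 := gmono _ _ (enorm_ge0 _) wv.
have : k * g (enorm (w - v)) <= k * g d by apply: ler_wpM2l => //; lra.
lra.
Qed.

(** Turns [Num.max e (e / enorm z)] into a linear function of [e >= 0]. *)
Let M := Num.max 1 (enorm z)^-1.

Lemma max_div_enormE e : 0 <= e -> Num.max e (e / enorm z) = M * e.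
Proof. by move=> e0; rewrite /M maxr_pMl // mul1r (mulrC _ e). Qed.

Lemma dist_orth x e : dual_cone (@Kexp R) z -> 0 <= e ->
  (edistance x (@Kexp R) <= e%:E)%E -> dot x z <= e ->
  exists q v, [/\ orth z q, enorm q <= enorm x, is_projection (@Kexp R) q v,
    enorm (x - q) <= M * e & enorm (q - v) <= e + M * e].
Proof.
move=> hz e0 xK xz.
have N0 : 0 < enorm z by rewrite enorm_gt0.
have K0 : @Kexp R !=set0.
  by exists 0; right; split; rewrite /xc /yc /zc mxE.
have [v0 xv0] := nearest_point_exists x K0 Kexp_closed.
have xv0e := projection_edist xv0 xK; have [Kv0 _] := xv0.
(* The hypothesis bounds [dot x z] only from above; the lower bound comes from a cone point [v0]
   within [e] of [x], where [dot v0 z >= 0]. *)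
have lo : - (e * enorm z) <= dot x z.
  have h1 : dot v0 z >= 0 by exact: hz.
  have : `|dot (x - v0) z| <= e * enorm z.
    by apply: le_trans (cauchy_schwarz _ _) _; rewrite ler_pM2r.
  by rewrite ler_norml dotBl => /andP[h2 _]; lra.
pose q := x - (dot x z / enorm z ^+ 2) *: z.
have qz : orth z q by exact: orth_proj_mem.
have xq : enorm (x - q) = `|dot x z| / enorm z.
  rewrite /q opprB addrC subrK enormZ normrM normfV normrX (ger0_norm (enorm_ge0 z)).
  by rewrite expr2 invfM -!mulrA mulVf ?gt_eqF // mulr1.
have xqM : enorm (x - q) <= M * e.
  rewrite xq -max_div_enormE // ler_pdivrMr // maxr_pMl ?(ltW N0) //.
  rewrite divfK ?gt_eqF // ler_norml.
  rewrite le_max xz orbT andbT lerNl le_max.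
  by apply/orP; left; lra.
have qx : enorm q <= enorm x.
  rewrite -ler_sqr ?nnegrE ?enorm_ge0 // -[in leRHS](subr0 x).
  rewrite (orth_proj_pythagoras x z0 (w := 0)) ?subr0 ?lerDr ?sqr_ge0 //.
  by rewrite /orth /= -(scale0r 0) dotZl mul0r.
have [v qv] := nearest_point_exists q K0 Kexp_closed.
(* [v] is at least as close to [q] as [v0], which is reached through [x]. *)
exists q, v; split => //; case: (qv) => _ vmin.
apply: le_trans (vmin _ Kv0) _; apply: le_trans (enorm_dist_triangle x _ _) _.
by rewrite enorm_distC addrC lerD.
Qed.

Let psi e t :=
  Num.max e (e / enorm z) + fine (kappa g z t) * g (e + Num.max e (e / enorm z)).

Lemma M_ge1 : 1 <= M.
Proof. by rewrite le_max lexx. Qed.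

Lemma residual_FRF : dual_cone (@Kexp R) z -> one_step_FRF (@Kexp R) z psi.
Proof.
move=> hz; have [g0 gid gmono] := hg; have M1 := M_ge1.
have g_ge0 t : 0 <= t -> 0 <= g t by move=> t0; apply: le_trans (gid _ t0).
have k2 t : 0 <= t -> 2 <= fine (kappa g z t).
  by move=> /hgamma[c c0 cg]; exact: kappa_ge2 (kappa_fin_num c0 cg).
have psiE e t : 0 <= e -> psi e t = M * e + fine (kappa g z t) * g (e + M * e).
  by move=> e0; rewrite /psi max_div_enormE.
split.
- move=> e t e0 t0; rewrite psiE //; have := k2 _ t0.
  have := g_ge0 (e + M * e); nra.
- move=> e1 e2 t e0 e12 t0; rewrite !psiE //; last lra.
  have := gmono (e1 + M * e1) (e2 + M * e2); have := k2 _ t0; nra.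
- move=> e t1 t2 e0 t10 t12; rewrite !psiE // lerD2l ler_wpM2r //.
    by apply: g_ge0; nra.
  by have [c c0 cg] := hgamma (le_trans t10 t12); exact: kappa_mono cg.
- by move=> t _; rewrite psiE // mulr0 addr0 g0 mulr0 addr0.
- move=> x e _ e0 xK xz; rewrite setIC hface.
  have [q [v [qz qx qv xq qvd]]] := dist_orth hz e0 xK xz.
  have [p Fp qp] := error_bound qz qx qv.
  apply: (edist_le Fp); apply: le_trans (enorm_dist_triangle q _ _) _.
  rewrite psiE //; apply: lerD => //; apply: le_trans qp _.
  rewrite ler_wpM2l ?gmono ?enorm_ge0 //.
  by have := k2 _ (enorm_ge0 x); lra.
Qed.

(** Since [e + M * e = (1 + M) * e], the scaling bound moves [1 + M] out of [g] and into [rho]. *)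
Lemma residual_FRF_separated : dual_cone (@Kexp R) z ->
  (forall L t, 1 <= L -> 0 <= t -> g (L * t) <= L * g t) ->
  exists (k : R) (rho : R -> R), [/\ 0 < k, nonneg_nondecreasing rho &
    one_step_FRF (@Kexp R) z (fun e t => k * e + rho t * g e)].
Proof.
move=> hz gscale; have [g0 gid gmono] := hg; have M1 := M_ge1.
have g_ge0 t : 0 <= t -> 0 <= g t by move=> t0; apply: le_trans (gid _ t0).
have k2 t : 0 <= t -> 2 <= fine (kappa g z t).
  by move=> /hgamma[c c0 cg]; exact: kappa_ge2 (kappa_fin_num c0 cg).
pose rho t := (1 + M) * fine (kappa g z t).
have rho0 t : 0 <= t -> 0 <= rho t by move=> /k2 ?; rewrite /rho; nra.
have rho_mono s t : 0 <= s -> s <= t -> rho s <= rho t.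
  move=> s0 st; have [c c0 cg] := hgamma (le_trans s0 st).
  by apply: ler_wpM2l; [lra|exact: kappa_mono cg].
exists M, rho; split; [lra|by split|].
have [_ _ _ _ frf] := residual_FRF hz.
split.
- by move=> e t e0 t0; have := rho0 _ t0; have := g_ge0 _ e0; nra.
- move=> e1 e2 t e0 e12 t0; have := rho0 _ t0; have := gmono _ _ e0 e12; nra.
- move=> e t1 t2 e0 t10 t12; rewrite lerD2l ler_wpM2r ?g_ge0 //; exact: rho_mono.
- by move=> t _; rewrite g0 !mulr0 addr0.
- move=> x e sx e0 xK xz; apply: le_trans (frf x e sx e0 xK xz) _.
  rewrite lee_fin /psi max_div_enormE // lerD2l /rho (mulrC (1 + M)) -mulrA ler_wpM2l //.
    by have := k2 _ (enorm_ge0 x); lra.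
  by rewrite -{1}[e]mul1r -mulrDl gscale //; lra.
Qed.

End Residual.

(** * Lower bounds for [gamma] in the two cases *)

Lemma gamma_positive_abs z : xc z = 0 -> 0 < yc z -> 0 < zc z ->
  gamma_positive (fun s => `|s|) z.
Proof.
move=> zx zy zz t _; pose m := Num.min (yc z) (zc z).
have m0 : 0 < m by rewrite lt_min zy zz.
have N0 : 0 < enorm z.
  by rewrite enorm_gt0; apply/eqP => z0; move: zy; rewrite z0 /yc mxE ltxx.
(* The 1 pays for the step from [w] to [v]; the other term bounds the distance from [v] to the face,
   by [h1] and [h2]. *)
pose B := 1 + 2 * enorm z / m.
have B0 : 0 < B by rewrite addr_gt0 // divr_gt0 // mulr_gt0.
exists B^-1; first by rewrite invr_gt0.
apply: gamma_ge => v w u Kv _ [wz _] [_ umin].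
rewrite ger0_norm ?enorm_ge0 // mulrC ler_pdivrMr //.
have [[Fv _] [ex ey ez]] := (Finf_proj_is_projection v, Finf_projE v).
have /KexpP[y0 s0 _] := Kv; have xys := Kexp_xc_le Kv.
have h1 : enorm (v - Finf_proj v) <= 2 * (yc v + zc v).
  rewrite -ler_sqr ?nnegrE ?enorm_ge0 ?mulr_ge0 ?addr_ge0 // sqr_enorm dot3E.
  have [-> -> ->] := coordB v (Finf_proj v); rewrite ex ey ez.
  (* A positive [xc v] is at most [zc v] by [xys]. *)
  by case: (leP (xc v) 0) => h; nra.
have h2 : m * (yc v + zc v) <= enorm (w - v) * enorm z.
  have my : m <= yc z by rewrite ge_min lexx.
  have mz : m <= zc z by rewrite ge_min lexx orbT.
  rewrite (enorm_distC w); apply: le_trans (cauchy_schwarz _ _).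
  apply: le_trans (ler_norm _); rewrite dotBl [dot w z]wz subr0 dot3E zx; nra.
have h3 : 2 * (yc v + zc v) <= enorm (w - v) * (2 * enorm z / m).
  rewrite (mulrA _ _ m^-1) ler_pdivlMr //; lra.
apply: le_trans (umin _ Fv) _; apply: le_trans (enorm_dist_triangle v _ _) _.
by rewrite /B mulrDr mulr1 lerD2l; lra.
Qed.

Lemma gamma_positive_ginf z : xc z = 0 -> yc z = 0 -> 0 < zc z ->
  gamma_positive (@ginf R) z.
Proof.
move=> zx zy zz t t0.
have z0 : z != 0 by apply/eqP => z0; move: zz; rewrite z0 /zc mxE ltxx.
have N2 : enorm z ^+ 2 = zc z * zc z by rewrite sqr_enorm dot3E zx zy; lra.
exists (2 * (1 + t))^-1; first by rewrite invr_gt0; lra.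
apply: gamma_ge => v w u Kv vt pw [_ umin].
have [[Fw _] [ex ey ez]] := (Finf_proj_is_projection w, Finf_projE w).
have /KexpP[y0 s0 _] := Kv; have xys := Kexp_xc_le Kv.
(* [z] lies on the third axis, so projecting only erases the third coordinate. *)
have [wx wy wz] : [/\ xc w = xc v, yc w = yc v & zc w = 0].
  have -> := is_projection_orth z0 pw.
  set a := dot v z / _; have [-> -> ->] := coordB v (a *: z).
  have [-> -> ->] := coordZ a z; rewrite zx zy !mulr0 !subr0; split => //.
  rewrite /a N2 dot3E zx zy !mulr0 !add0r invfM mulrA mulfK ?gt_eqF //.
  by rewrite divfK ?gt_eqF // subrr.
have wv : enorm (w - v) = zc v.
  apply/eqP; rewrite -(eqrXn2 (n := 2)) ?enorm_ge0 // sqr_enorm dot3E.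
  have [-> -> ->] := coordB w v; rewrite wx wy wz; apply/eqP; lra.
rewrite wv; apply: (@le_trans _ _ ((2 * (1 + t))^-1 * enorm (w - Finf_proj w))).
  by rewrite ler_pM2l ?umin // invr_gt0; lra.
have D2 : enorm (w - Finf_proj w) ^+ 2 = (xc v - Num.min (xc v) 0) ^+ 2 + yc v ^+ 2.
  rewrite sqr_enorm dot3E; have [-> -> ->] := coordB w (Finf_proj w).
  by rewrite ex ey ez wx wy wz; lra.
have c1 : (2 * (1 + t))^-1 <= 1 by rewrite invf_le1; lra.
have gs := ginf_id_le s0; have D0 := enorm_ge0 (w - Finf_proj w).
set D := enorm (w - Finf_proj w) in D2 D0 *.
have [x0|x0] := leP 0 (xc v).
  have Ds : D <= zc v.
    by rewrite -ler_sqr ?nnegrE // D2 min_r // subr0; nra.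
  have : (2 * (1 + t))^-1 * D <= D by apply: ler_piMl.
  lra.
have Dy : D = yc v.
  by apply/eqP; rewrite -(eqrXn2 (n := 2)) // D2 min_l ?ltW // subrr expr0n /= add0r.
(* On the flat part [yc v = 0] the distance [D] vanishes. *)
rewrite Dy; case: Kv => [[yp sv]|[_ _ ->]]; last by rewrite mulr0 ginf_ge0.
rewrite mulrC; apply: (@le_trans _ _ (ginf (yc v * expR (xc v / yc v)))).
  apply: ginf_perspective_ge => //; last 2 [exact: ltW].
  - by apply: le_trans vt; apply: le_trans (ler_norm _) (coord_le_enorm v 1).
  - by apply: le_trans vt; apply: le_trans (coord_le_enorm v 0); rewrite -normrN ler_norm.
by apply: ginf_mono => //; rewrite mulr_ge0 ?expR_ge0.
Qed.

(** The third basis vector lies in the cone but not in [Finf], so it cannot be orthogonal to [z]. *)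
Lemma zc_gt0 z : dual_cone (@Kexp R) z -> orth z `&` @Kexp R = @Finf R -> 0 < zc z.
Proof.
move=> hz hface; pose e3 : 'rV[R]_3 := delta_mx 0 2.
have [x3 y3 z3] : [/\ xc e3 = 0, yc e3 = 0 & zc e3 = 1] by rewrite /xc /yc /zc !mxE.
have K3 : Kexp e3 by right; rewrite /= x3 y3 z3.
have d3 : dot e3 z = zc z by rewrite dot3E x3 y3 z3; lra.
rewrite lt_def -{2}d3 hz // andbT; apply/eqP => zz.
have [_ _] : Finf e3 by rewrite -hface; split => //; rewrite /orth /= d3.
by rewrite z3 => /eqP; rewrite oner_eq0.
Qed.

End ExponentialCone.

(** * The cases [0 < yc z] and [yc z = 0], with the absolute value and [ginf] as gauges *)

Theorem corollary4p11 (R : realType) (z : 'rV[R]_3)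
    (hz : dual_cone (@Kexp R) z) (hzx : xc z = 0)
    (hface : orth z `&` @Kexp R = @Finf R) :
  (0 < yc z ->
    [/\ forall t : R, 0 <= t -> kappa (fun s : R => `|s|) z t \is a fin_num,
        one_step_FRF (@Kexp R) z (fun e t =>
          Num.max e (e / enorm z) +
          fine (kappa (fun s : R => `|s|) z t) *
            (e + Num.max e (e / enorm z))) &
        exists (k : R) (rho : R -> R),
          [/\ 0 < k, nonneg_nondecreasing rho &
              one_step_FRF (@Kexp R) z (fun e t => k * e + rho t * e)]])
  /\
  (yc z = 0 ->
    [/\ forall t : R, 0 <= t -> kappa (@ginf R) z t \is a fin_num,
        one_step_FRF (@Kexp R) z (fun e t =>
          Num.max e (e / enorm z) +
          fine (kappa (@ginf R) z t) *
            ginf (e + Num.max e (e / enorm z))) &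
        exists (k : R) (rho : R -> R),
          [/\ 0 < k, nonneg_nondecreasing rho &
              one_step_FRF (@Kexp R) z
                (fun e t => k * e + rho t * ginf e)]]).
Proof.
have zz := zc_gt0 hz hface.
have z0 : z != 0 by apply/eqP => z0; move: zz; rewrite z0 /zc mxE ltxx.
have fin g : gamma_positive g z -> forall t, 0 <= t -> kappa g z t \is a fin_num.
  by move=> hgamma t /hgamma[c c0 cg]; exact: kappa_fin_num cg.
split=> zy.
- have hg : gauge (fun s : R => `|s|).
    split=> [|t _|s t s0 st]; rewrite ?normr0 ?ler_norm //.
    by rewrite !ger0_norm // (le_trans s0).
  have hgamma := gamma_positive_abs hzx zy zz.
  split; first exact: fin.
    apply: eq_one_step_FRF (residual_FRF z0 hface hg hgamma hz) => e t e0 _.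
    by rewrite ger0_norm // addr_ge0 // le_max e0.
  have [L t L1 _|k [rho [k0 rho_mono frf]]] :=
    residual_FRF_separated z0 hface hg hgamma hz.
    by rewrite normrM ger0_norm //; lra.
  exists k, rho; split => //.
  by apply: eq_one_step_FRF frf => e t e0 _; rewrite ger0_norm.
- have hg : gauge (@ginf R) by split; [exact: ginf0|exact: ginf_id_le|exact: ginf_mono].
  have hgamma := gamma_positive_ginf hzx zy zz.
  split; first exact: fin.
    exact: residual_FRF.
  by apply: residual_FRF_separated => //; exact: ginf_scale.
Qed.
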